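(* Let $p$ be a prime number with $p\ne2$, let $x\in\mathbb Z(p^\infty)$ be a non-zero element with $o(x)=p^{n_0}$, and for $n\ge1$ put $$b_n=-x+e_{n^3-n^2}+\cdots+e_{n^3-2n}+e_{n^3-n}+e_{n^3}=-x+\sum_{j=0}^{n}\frac1{p^{n^3-jn}}\in\mathbb Z(p^\infty).$$ Consider the sequence $\{d_n\}$ defined as $b_1,e_1,b_2,e_2,b_3,e_3,\ldots$. Then: (a) $\{d_n\}$ is a $T$-sequence in $\mathbb Z(p^\infty)$; (b) the underlying group of the group $\widehat{\mathbb Z(p^\infty)\{d_n\}}$ of continuous characters is $p^{n_0}\mathbb Z\subseteq\mathbb Z_p=\hom_{\mathbb Z}(\mathbb Z(p^\infty),\mathbb T)$; (c) $\mathbf n(\mathbb Z(p^\infty)\{d_n\})=\langle x\rangle$. In particular, $\mathbb Z(p^\infty)\{d_n\}$ is neither maximally almost-periodic nor minimally almost-periodic, and $\mathbf n(\mathbb Z(p^\infty)\{d_n\})$ is finite.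
   Context: $\mathbb Z(p^\infty)$ is the Prüfer group, i.e. the subgroup of $\mathbb Q/\mathbb Z$ consisting of the elements of $p$-power order, and $e_n=\frac1{p^n}\in\mathbb Z(p^\infty)$ (taken modulo $\mathbb Z$, so $e_0=0$). $o(x)$ is the order of $x$. $\mathbb T=\mathbb R/\mathbb Z$. A sequence $\{a_n\}$ in a group $G$ is a $T$-sequence if there is a Hausdorff group topology $\tau$ on $G$ such that $a_n\to 0$ (the neutral element) in $\tau$. In this case $G\{a_n\}$ denotes $G$ equipped with the finest group topology in which $a_n\to 0$. For an abelian topological group $A$, $\hat A$ is the group of continuous homomorphisms $\chi\colon A\to\mathbb T$ (continuous characters), and the von Neumann radical of $A$ is $\mathbf n(A)=\bigcap_{\chi\in\hat A}\ker\chi$. $A$ is maximally almost-periodic if $\mathbf n(A)=\{0\}$ and minimally almost-periodic if $\mathbf n(A)=A$. The group $\hom_{\mathbb Z}(\mathbb Z(p^\infty),\mathbb T)$ of all characters of the abstract group $\mathbb Z(p^\infty)$ is identified with the group $\mathbb Z_p$ of $p$-adic integers: $\sum_{l\ge0}\alpha_lp^l$ (with $0\le\alpha_l\le p-1$) corresponds to the character with $e_n\mapsto\sum_{l=0}^{n-1}\alpha_lp^{l-n}\bmod 1$. Under this identification an integer $m\in\mathbb Z\subseteq\mathbb Z_p$ corresponds to $m\chi_1$, where $\chi_1$ is the natural embedding of $\mathbb Z(p^\infty)$ into $\mathbb T$. *)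

(* Defs.v *)
From HB Require Import structures.
From mathcomp Require Import all_boot all_order all_algebra.
From mathcomp Require Import generic_quotient ring_quotient.
From mathcomp Require Import all_classical all_reals all_analysis.
Import numFieldNormedType.Exports.

Set Implicit Arguments.
Unset Strict Implicit.
Unset Printing Implicit Defensive.

Import Order.TTheory GRing.Theory Num.Theory.

Local Open Scope classical_set_scope.
Local Open Scope quotient_scope.
Local Open Scope ring_scope.

(* A topology on T given by its open sets; `topologized` and `topgroup` turn
   such a topology into an instance of the library structures on an alias of
   the carrier, so that one can quantify over the topologies of a fixed group. *)
Record topology (T : Type) := Topology {
  opens : set (set T);
  opens_setT : opens setT;
  opens_setI : setI_closed opens;
  opens_bigcup : forall (I : Type) (f : I -> set T),
    (forall i, opens (f i)) -> opens (\bigcup_i f i)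
}.

Definition topologized (T : choiceType) (tau : topology T) : Type := T.

HB.instance Definition _ (T : choiceType) (tau : topology T) :=
  Choice.on (topologized tau).
HB.instance Definition _ (T : choiceType) (tau : topology T) :=
  isOpenTopological.Build (topologized tau)
    (opens_setT tau) (@opens_setI _ tau) (@opens_bigcup _ tau).

Record group_topology (G : zmodType) := GroupTopology {
  group_topology_topology :> topology G;
  group_topology_sub : continuous
    (fun z : topologized group_topology_topology *
             topologized group_topology_topology =>
       ((z.1 : G) - (z.2 : G) : topologized group_topology_topology))
}.

Definition topgroup (G : zmodType) (tau : group_topology G) : Type :=
  topologized tau.

HB.instance Definition _ (G : zmodType) (tau : group_topology G) :=
  Topological.on (topgroup tau).
HB.instance Definition _ (G : zmodType) (tau : group_topology G) :=
  GRing.Zmodule.copy (topgroup tau) G.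
HB.instance Definition _ (G : zmodType) (tau : group_topology G) :=
  PreTopologicalNmodule_isTopologicalZmodule.Build (topgroup tau)
    (@group_topology_sub G tau).

Definition null_sequence (G : zmodType) (tau : group_topology G) (a : nat -> G) :=
  (a : nat -> topgroup tau) @ \oo --> (0 : topgroup tau).

Definition T_sequence (G : zmodType) (a : nat -> G) : Prop :=
  exists2 tau : group_topology G,
    hausdorff_space (topgroup tau) & null_sequence tau a.

Section FinestTopology.
Variables (G : zmodType) (a : nat -> G).

Let I := {tau : group_topology G | null_sequence tau a}.
Let Tc (i : I) : Topological G := Topological.class (topgroup (sval i)).
Let S := sup_topology Tc.

(* The supremum of all the group topologies for which a tends to 0; it is itself
   such a topology, hence the finest one, see `finest_null_sequence` and
   `finest_group_topology_finest`. *)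
Definition finest_topology : topology G :=
  @Topology G (@open S) (@openT S) (@openI S)
    (fun J f fo => bigcup_open (fun i _ => fo i)).

Lemma finest_nbhsE (x : G) :
  @nbhs _ (topologized finest_topology) x = @nbhs _ S x.
Proof.
exact: etrans (@nbhsE (topologized finest_topology) x) (esym (@nbhsE S x)).
Qed.

Lemma finest_le (i : I) (x : G) :
  @nbhs _ (topgroup (sval i)) x `<=` @nbhs _ (topologized finest_topology) x.
Proof.
rewrite finest_nbhsE.
exact: (iffLR (@cvg_sup _ _ Tc (@nbhs _ S x) x _) (@cvg_refl _ _) i).
Qed.

Lemma finest_topology_sub : continuous
  (fun z : topologized finest_topology * topologized finest_topology =>
     ((z.1 : G) - (z.2 : G) : topologized finest_topology)).
Proof.
move=> [x y] A; rewrite finest_nbhsE; move: A.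
change ((fun z : topologized finest_topology * topologized finest_topology =>
  ((z.1 : G) - (z.2 : G) : S)) @ (x, y) --> (x - y : S)).
apply/cvg_sup => i A /=.
move=> /(@group_topology_sub G (sval i) (x, y)) [[U V]] /= [Ux Vy] UVA.
by exists (U, V) => //; split; exact: (finest_le (i := i)).
Qed.

Definition finest_group_topology := GroupTopology finest_topology_sub.

Lemma finest_null_sequence : null_sequence finest_group_topology a.
Proof.
move=> A; rewrite [nbhs _]finest_nbhsE; move: A.
by apply/(cvg_sup Tc) => i; exact: (svalP i).
Qed.

Lemma finest_group_topology_finest (tau : group_topology G) :
  null_sequence tau a -> opens tau `<=` opens finest_group_topology.
Proof.
move=> taua A oA.
change (@open (topologized finest_topology) A); rewrite openE => x Ax.
by apply: (@finest_le (exist _ tau taua)); exact: open_nbhs_nbhs.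
Qed.

Definition finest_topgroup : topologicalZmodType := topgroup finest_group_topology.

End FinestTopology.

(* The additive group F / Z. *)
Definition modZ (F : archiNumDomainType) : Type :=
  Quotient.quot (GRing.ZmodClosed.clone F (@Num.int_num_subdef F) _).
HB.instance Definition _ (F : archiNumDomainType) := GRing.Zmodule.on (modZ F).
HB.instance Definition _ (F : archiNumDomainType) := Quotient.on (modZ F).

Definition circle (R : realType) : Type := quotient_topology (modZ R).
HB.instance Definition _ (R : realType) := Topological.on (circle R).
HB.instance Definition _ (R : realType) := GRing.Zmodule.copy (circle R) (modZ R).

Lemma modZ_eq0 (F : archiNumDomainType) (q : F) :
  (\pi_(modZ F) q == 0) = (q \is a Num.int).
Proof.
rewrite -[0 in LHS](raddf0 \pi_(modZ F)) -[q in RHS]subr0.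
exact/esym/(Quotient.idealrBE (GRing.ZmodClosed.clone F (@Num.int_num_subdef F) _)).
Qed.

(* For a prime p these are the elements whose order is a power of p, see
   `pruefer_predP`. *)
Definition pruefer_pred (p : nat) : {pred modZ rat} :=
  fun x => `[< exists n, x *+ (p ^ n)%N = 0 >].

Fact pruefer_zmod_closed p : zmod_closed (pruefer_pred p).
Proof.
split=> [|x y /asboolP[m xm] /asboolP[n yn]].
  by apply/asboolP; exists 0%N; rewrite mul0rn.
apply/asboolP; exists (m + n)%N.
by rewrite mulrnBl expnD mulrnA xm mul0rn mulnC mulrnA yn mul0rn subrr.
Qed.
HB.instance Definition _ p :=
  GRing.isZmodClosed.Build (modZ rat) (pruefer_pred p) (pruefer_zmod_closed p).

Record pruefer (p : nat) := Pruefer {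
  pruefer_val :> modZ rat;
  pruefer_valP : pruefer_val \in pruefer_pred p
}.
HB.instance Definition _ p := [isSub for @pruefer_val p].
HB.instance Definition _ p := [Choice of pruefer p by <:].
HB.instance Definition _ p := [SubChoice_isSubZmodule of pruefer p by <:].

Definition has_order (G : zmodType) (x : G) (n : nat) : Prop :=
  [/\ (0 < n)%N, x *+ n = 0
    & forall m, (0 < m)%N -> x *+ m = 0 -> (n <= m)%N].

Lemma pruefer_predP (p : nat) (x : modZ rat) : prime p ->
  reflect (exists k, has_order x (p ^ k)%N) (x \in pruefer_pred p).
Proof.
move=> p_pr; apply: (iffP (asboolP _)) => [[n xn]|[k [_ xk _]]]; last by exists k.
have ex : exists m, (0 < m)%N && (x *+ m == 0).
  by exists (p ^ n)%N; rewrite expn_gt0 prime_gt0// xn eqxx.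
have [m /andP[m0 /eqP xm] m_min] := ex_minnP ex.
suff /(dvdn_pfactor _ _ p_pr)[k _ mE] : (m %| p ^ n)%N.
  exists k; rewrite -mE; split=> // j j0 /eqP xj.
  by apply: m_min; rewrite j0.
rewrite /dvdn; apply: contraT; rewrite -lt0n => r0.
have : (m <= p ^ n %% m)%N.
  apply: m_min; rewrite r0 /=; apply/eqP.
  by move: xn; rewrite {1}(divn_eq (p ^ n) m) mulrnDr mulnC mulrnA xm mul0rn add0r.
by rewrite leqNgt ltn_mod m0.
Qed.

Fact pruefer_gen_subproof (p n : nat) :
  \pi_(modZ rat) ((p ^ n)%N%:R^-1 : rat) \in pruefer_pred p.
Proof.
apply/asboolP; exists n; apply/eqP.
rewrite -raddfMn modZ_eq0 -[_ *+ (p ^ n)]mulr_natr.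
have [->|pn0] := eqVneq ((p ^ n)%N%:R : rat) 0; first by rewrite mulr0 rpred0.
by rewrite mulVf// rpred1.
Qed.

(* The class e_n of 1 / p ^ n. *)
Definition pruefer_gen (p n : nat) : pruefer p :=
  Pruefer (pruefer_gen_subproof p n).

(* The embedding chi_1 induced by the inclusion of rat into R; it does not depend
   on the representative, see `natural_charE`. *)
Definition natural_char (R : realType) (p : nat) (x : pruefer p) : circle R :=
  \pi_(modZ R) (ratr (repr (val x))).

Arguments natural_char R {p} x.

Lemma natural_charE (R : realType) (p : nat) (x : pruefer p) (q : rat) :
  val x = \pi_(modZ rat) q -> natural_char R x = \pi_(modZ R) (ratr q).
Proof.
move=> xq; apply: (@subr0_eq (modZ R)); apply/eqP.
rewrite -(raddfB \pi_(modZ R)) modZ_eq0 -rmorphB.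
have : \pi_(modZ rat) (repr (val x) - q) == 0 by rewrite raddfB /= reprK xq subrr.
by rewrite modZ_eq0 => /intrP[m ->] /=; rewrite ratr_int intr_int.
Qed.

Lemma natural_char_additive (R : realType) (p : nat) :
  zmod_morphism (@natural_char R p).
Proof.
move=> x y; rewrite (@natural_charE _ _ _ (repr (val x) - repr (val y))).
  by rewrite rmorphB raddfB.
by rewrite !raddfB /= !reprK.
Qed.

(* The p-adic integer \sum_l alpha_l p ^ l, given by its digits. *)
Definition padic (p : nat) : Type := nat -> 'I_p.

Definition padic_trunc (p : nat) (alpha : padic p) (n : nat) : nat :=
  \sum_(l < n) alpha l * p ^ l.

Fact pruefer_torsion (p : nat) (x : pruefer p) :
  exists n, x *+ (p ^ n)%N == 0.
Proof.
have /asboolP[n xn] := valP x.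
by exists n; apply/eqP/val_inj; rewrite raddfMn.
Qed.

(* The character of the p-adic integer alpha: an x killed by p ^ n is sent to
   \sum_(l < n) alpha_l p ^ l times chi_1 x, for any such n (`padic_truncE`).
   The values at the e_n are given by `padic_char_gen`. *)
Definition padic_char (R : realType) (p : nat) (alpha : padic p)
    (x : pruefer p) : circle R :=
  natural_char R (x *+ padic_trunc alpha (ex_minn (pruefer_torsion x))).

Arguments padic_char R {p} alpha x.

Lemma padic_truncE (p : nat) (alpha : padic p) (x : pruefer p) (n : nat) :
  x *+ (p ^ n)%N = 0 ->
  x *+ padic_trunc alpha (ex_minn (pruefer_torsion x))
    = x *+ padic_trunc alpha n.
Proof.
move=> xn; case: ex_minnP => m /eqP xm m_min.
have /m_min mn : x *+ (p ^ n)%N == 0 by apply/eqP.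
rewrite /padic_trunc -(subnKC mn) big_split_ord mulrnDr /=.
rewrite [X in _ + _ *+ X](_ : _ = p ^ m * \sum_(l < n - m)
  alpha (m + l) * p ^ l)%N; last first.
  by rewrite big_distrr; apply: eq_bigr => l _; rewrite expnD mulnCA.
by rewrite mulrnA xm mul0rn addr0.
Qed.

Lemma padic_char_additive (R : realType) (p : nat) (alpha : padic p) :
  zmod_morphism (padic_char R alpha).
Proof.
move=> x y; have [m /eqP xm] := pruefer_torsion x.
have [n /eqP yn] := pruefer_torsion y.
have xmn : x *+ (p ^ (m + n))%N = 0 by rewrite expnD mulrnA xm mul0rn.
have ymn : y *+ (p ^ (m + n))%N = 0 by rewrite expnD mulnC mulrnA yn mul0rn.
rewrite /padic_char (padic_truncE _ xmn) (padic_truncE _ ymn).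
rewrite (@padic_truncE _ _ _ (m + n)) ?mulrnBl ?xmn ?ymn ?subrr//.
exact: natural_char_additive.
Qed.

Lemma padic_char_gen (R : realType) (p : nat) (alpha : padic p) (n : nat) :
  prime p ->
  padic_char R alpha (pruefer_gen p n)
  = \pi_(modZ R) (\sum_(l < n) (alpha l)%:R / p%:R ^+ (n - l)).
Proof.
move=> p_pr; rewrite /padic_char (@padic_truncE _ _ _ n); last first.
  apply/val_inj; rewrite raddfMn /= -raddfMn; apply/eqP; rewrite modZ_eq0.
  by rewrite -[_ *+ (p ^ n)]mulr_natr mulVf ?rpred1// pnatr_eq0 -lt0n expn_gt0 prime_gt0.
rewrite (@natural_charE _ _ _ ((p ^ n)%N%:R^-1 *+ padic_trunc alpha n)); last first.
  by rewrite !raddfMn.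
congr (\pi_(modZ R) _); rewrite rmorphMn /= fmorphV /= ratr_nat -mulr_natl.
rewrite natr_sum mulr_suml; apply: eq_bigr => l _.
have p0 : p%:R != 0 :> R by rewrite pnatr_eq0 -lt0n prime_gt0.
have -> : (p ^ n)%N%:R = p%:R ^+ (n - l) * p%:R ^+ l :> R.
  by rewrite -exprD subnK ?natrX// ltnW.
by rewrite natrM natrX invfM -mulrA [X in _ * (_ * X)]mulrC mulVKf ?expf_neq0.
Qed.

Fact padic_digit_subproof (p : nat) (m : int) (l : nat) : prime p ->
  (`|((m %/ (p ^ l)%N)%Z %% p)%Z| < p)%N.
Proof.
move=> /prime_gt0 p0.
by rewrite -ltz_nat gez0_abs ?modz_ge0 ?ltz_pmod// -?lt0n// eqz_nat -lt0n.
Qed.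

(* The digits of an integer in Z_p; divz and modz round towards -oo here, so
   that -1 has all its digits equal to p - 1. *)
Definition padic_of_int (p : nat) (p_pr : prime p) (m : int) : padic p :=
  fun l => Ordinal (padic_digit_subproof m l p_pr).

Lemma padic_of_intE (p : nat) (p_pr : prime p) (m : int) (n : nat) :
  (padic_trunc (padic_of_int p_pr m) n)%:Z = (m %% (p ^ n)%N%:Z)%Z.
Proof.
have p0 := prime_gt0 p_pr.
have pn0 k : (p ^ k)%N%:Z != 0 by rewrite eqz_nat -lt0n expn_gt0 p0.
elim: n => [|n IH]; first by rewrite /padic_trunc big_ord0 expn0 modz1.
rewrite /padic_trunc big_ord_recr /= -/(padic_trunc _ n) PoszD IH PoszM.
rewrite gez0_abs; last by rewrite modz_ge0// eqz_nat -lt0n.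
set P := (p ^ n)%N%:Z; set q := (m %/ P)%Z; set r := (m %% P)%Z.
have P0 : 0 < P by rewrite ltz_nat expn_gt0 p0.
have r_ge0 : 0 <= r by rewrite /r modz_ge0// gt_eqF.
have r_lt : r < P by rewrite ltz_pmod.
have d_ge0 : 0 <= (q %% p)%Z by rewrite modz_ge0// eqz_nat -lt0n.
have d_lt : (q %% p)%Z + 1 <= p by rewrite addrC lez1D ltz_pmod.
have pE : (p ^ n.+1)%N%:Z = p%:Z * P by rewrite expnS PoszM.
have mE : m = (q %/ p)%Z * (p ^ n.+1)%N%:Z + (r + (q %% p)%Z * P).
  rewrite pE mulrA [r + _]addrC addrA -mulrDl -divz_eq; exact: divz_eq.
rewrite [m in RHS]mE modzMDl; apply/esym/modz_small/andP; split.
  by rewrite addr_ge0// mulr_ge0// ltW.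
rewrite pE (lt_le_trans _ (ler_wpM2r (ltW P0) d_lt))//.
by rewrite (mulrDl (q %% p)%Z 1 P) mul1r [X in X < _]addrC ltrD2l.
Qed.

Lemma padic_char_int (R : realType) (p : nat) (p_pr : prime p) (m : int) :
  padic_char R (padic_of_int p_pr m) = (fun x => natural_char R x *~ m).
Proof.
apply/funext => x; have [n /eqP xn] := pruefer_torsion x.
rewrite /padic_char (padic_truncE _ xn).
have -> : x *+ padic_trunc (padic_of_int p_pr m) n = x *~ m.
  rewrite pmulrn padic_of_intE [in RHS](divz_eq m (p ^ n)%N).
  rewrite [RHS]mulrzDr [X in X + _](_ : _ = 0) ?add0r// mulrC.
  by rewrite mulrzA -pmulrn xn mul0rz.
pose chi : {additive pruefer p -> modZ R} := HB.pack (@natural_char R p)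
  (GRing.isZmodMorphism.Build _ (modZ R) _ (@natural_char_additive R p)).
exact: (raddfMz chi).
Qed.

Definition dual (R : realType) (A : topologicalZmodType) : set (A -> circle R) :=
  [set chi : A -> circle R | zmod_morphism chi /\ continuous chi].
Arguments dual : clear implicits.

Definition von_neumann_radical (R : realType) (A : topologicalZmodType) : set A :=
  \bigcap_(chi in dual R A) [set x | chi x = 0].
Arguments von_neumann_radical : clear implicits.

Definition maximally_almost_periodic (R : realType) (A : topologicalZmodType) :=
  von_neumann_radical R A = [set 0].

Definition minimally_almost_periodic (R : realType) (A : topologicalZmodType) :=
  von_neumann_radical R A = [set: A].

Definition b_seq (p : nat) (x : pruefer p) (n : nat) : pruefer p :=
  - x + \sum_(0 <= j < n.+1) pruefer_gen p (n ^ 3 - j * n).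

(* The interleaving b_1, e_1, b_2, e_2, ..., indexed from 0. *)
Definition d_seq (p : nat) (x : pruefer p) (k : nat) : pruefer p :=
  if odd k then pruefer_gen p k./2.+1 else b_seq x k./2.+1.

(* Main.v *)
(* Continuity of a character on the finest topology only requires that it sends the
   sequence to 0. If chi(e_n) -> 0 then the small lifts of chi(e_n) to R are
   eventually divided by p at each step, so chi = m chi_1 for an integer m; the
   sums b_n + x tend to 0 on the circle, so chi(b_n) -> 0 forces m x = 0.

   For the T-sequence property we use the criterion of Protasov and Zelenyuk: it
   suffices that for every k no g <> 0 is, for all m, a sum of at most k terms
   among 0 and +-d_n, n >= m. In such a sum let n be the largest index for which
   the total coefficient c of b_n is nonzero. Each term e_i spoils at most one of
   the disjoint windows of length 2n below n^3, so some window contains no such i.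
   Multiplying by the power of p at the bottom of that window kills g, x and
   the b_i with i < n, and leaves c / p^n plus an error of order k^2 / p^(2n)
   in Z, which is absurd. If all the coefficients c vanish, g is a sum of k terms
   +-e_i, hence close to 0 on the circle, and g = 0. *)
Require Import Defs.
From HB Require Import structures.
From mathcomp Require Import all_boot all_order all_algebra.
From mathcomp Require Import generic_quotient ring_quotient.
From mathcomp Require Import all_classical all_reals all_analysis.
From mathcomp Require Import zify ring lra.
Import numFieldNormedType.Exports.

Set Implicit Arguments.
Unset Strict Implicit.
Unset Printing Implicit Defensive.

Import Order.TTheory GRing.Theory Num.Theory.

Local Open Scope classical_set_scope.
Local Open Scope quotient_scope.
Local Open Scope ring_scope.

(** * Group topologies given by a base of neighbourhoods of 0 *)

Definition group_base (G : zmodType) (I : Type) (B : I -> set G) : Prop :=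
  [/\ forall i, B i 0,
      forall i j, exists k, B k `<=` B i `&` B j
    & forall i, exists j, forall u v, B j u -> B j v -> B i (u - v)].

Lemma group_base_topology (G : zmodType) (I : Type) (i0 : I) (B : I -> set G) :
  group_base B ->
  exists tau : group_topology G, forall (x : topgroup tau) (A : set (topgroup tau)),
    nbhs x A <-> exists i, forall u, B i u -> A ((x : G) + u).
Proof.
move=> [B0 BI BB].
have BD i : exists j, forall u v, B j u -> B j v -> B i (u + v).
  have [j ji] := BB i; have [k kj] := BB j.
  exists k => u v ku kv; rewrite -[v]opprK; apply: ji.
    by rewrite -[u]subr0; exact: kj.
  by rewrite -sub0r; exact: kj.
pose ops : set (set G) :=
  [set O | forall x, O x -> exists i, forall u, B i u -> O (x + u)].
have opsT : ops setT by move=> x _; exists i0.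
have opsI : setI_closed ops.
  move=> X Y oX oY x [/oX[i iX] /oY[j jY]]; have [k kij] := BI i j.
  by exists k => u /kij[/iX ? /jY].
have opsU (J : Type) (f : J -> set G) :
    (forall j, ops (f j)) -> ops (\bigcup_j f j).
  move=> of_ x [j _ /of_[i iX]]; exists i => u /iX ?.
  by exists j.
pose T := Topology opsT opsI opsU.
have nbhsT (x : topologized T) (A : set (topologized T)) :
    nbhs x A <-> exists i, forall u, B i u -> A ((x : G) + u).
  split.
    by rewrite nbhsE => -[X [oX Xx] XA]; have [i iX] := (oX : ops X) x Xx;
      exists i => u /iX/XA.
  move=> [i iA]; rewrite nbhsE.
  (* This is the interior of A: it is open because [BD] provides B_k with B_k + B_k inside B_j. *)
  exists [set y : G | exists i, forall u, B i u -> A (y + u)].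
    split; last by exists i.
    suff : ops [set y : G | exists i, forall u, B i u -> A (y + u)] by [].
    move=> y [j jA]; have [k kj] := BD j; exists k => u ku; exists k => v kv.
    by rewrite -addrA; exact/jA/kj.
  by move=> y [j jA]; rewrite -[y]addr0; exact: jA.
have sub_cont : continuous (fun z : topologized T * topologized T =>
    ((z.1 : G) - (z.2 : G) : topologized T)).
  move=> [x y] A /nbhsT[i iA]; have [j ji] := BB i.
  exists ([set z : G | B j (z - x)], [set z : G | B j (z - y)]) => /=.
    by split; apply/nbhsT; exists j => u; rewrite /= addrC addKr.
  move=> [z w] /= [zx wy].
  have -> : (z : G) - (w : G) = x - y + ((z - x) - (w - y)).
    by rewrite -[z in LHS](subrK x) -[w in LHS](subrK y) opprD addrACA addrC.
  exact/iA/ji.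
by exists (GroupTopology sub_cont).
Qed.

Lemma group_base_null (G : zmodType) (I : Type) (B : I -> set G)
    (tau : group_topology G) (a : nat -> G) :
  (forall (x : topgroup tau) (A : set (topgroup tau)),
    nbhs x A <-> exists i, forall u, B i u -> A ((x : G) + u)) ->
  (forall i, \forall n \near \oo, B i (a n)) -> null_sequence tau a.
Proof.
move=> tauE aB A /tauE[i iA]; have := aB i.
by apply: filterS => n /iA; rewrite add0r.
Qed.

(** * The criterion of Protasov and Zelenyuk for T-sequences *)

Section Criterion.
Variables (G : zmodType) (a : nat -> G).

Definition tail (m : nat) : set G :=
  [set g | g = 0 \/ exists2 n, (m <= n)%N & g = a n \/ g = - a n].

(** The bound depends on the position of the term. With arbitrary [mu], the unions over k form a
    neighbourhood base of 0; constant bounds appear in the hypothesis of the criterion. *)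
Fixpoint tail_sum (mu : nat -> nat) (k : nat) : set G :=
  if k is k.+1 then [set g | exists2 u, tail_sum mu k u & tail (mu k) (g - u)]
  else [set 0].

Definition tail_sums (mu : nat -> nat) : set G := \bigcup_k tail_sum mu k.

Lemma tail0 m : tail m 0. Proof. by left. Qed.

Lemma tailN m g : tail m g -> tail m (- g).
Proof.
move=> [->|[n mn gE]]; first by left; rewrite oppr0.
by right; exists n => //; case: gE => ->; rewrite ?opprK; [right|left].
Qed.

Lemma tailS m m' : (m <= m')%N -> tail m' `<=` tail m.
Proof.
by move=> mm' g [->|[n mn gE]]; [left|right; exists n => //; exact: leq_trans mn].
Qed.

Lemma tail_sumW mu k l : (k <= l)%N -> tail_sum mu k `<=` tail_sum mu l.
Proof.
move=> /subnK<-; elim: (l - k)%N => // i IH g /IH gi.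
by exists g => //; rewrite subrr; exact: tail0.
Qed.

Lemma tail_sum_le mu nu k : (forall i, nu i <= mu i)%N ->
  tail_sum mu k `<=` tail_sum nu k.
Proof.
move=> numu; elim: k => // k IH g [u /IH ku gu]; exists u => //.
exact: tailS gu.
Qed.

Lemma tail_sumN mu k g : tail_sum mu k g -> tail_sum mu k (- g).
Proof.
elim: k g => [g ->|k IH g [u /IH ku gu]]; first by rewrite /= oppr0.
by exists (- u) => //; rewrite -opprD; exact: tailN.
Qed.

(** The i-th terms of u and v become the terms 2i and 2i + 1 of the sum, and the maximum meets the
    bounds of both positions. *)
Lemma tail_sumD mu k u v :
  tail_sum (fun i => maxn (mu i.*2) (mu i.*2.+1)) k u ->
  tail_sum (fun i => maxn (mu i.*2) (mu i.*2.+1)) k v ->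
  tail_sum mu k.*2 (u + v).
Proof.
elim: k u v => [u v -> ->|k IH u v [u' ku uu'] [v' kv vv']]; first by rewrite /= addr0.
rewrite doubleS; exists (u + v').
  exists (u' + v'); first exact: IH.
  by rewrite opprD addrACA subrr addr0; apply: tailS uu'; exact: leq_maxl.
by rewrite opprD addrACA subrr add0r; apply: tailS vv'; exact: leq_maxr.
Qed.

Lemma tail_sums_base : group_base tail_sums.
Proof.
split=> [mu|mu nu|mu].
- by exists 0%N.
- exists (fun i => maxn (mu i) (nu i)) => g [k _ kg].
  by split; exists k => //; apply: tail_sum_le kg => i; rewrite ?leq_maxl ?leq_maxr.
- exists (fun i => maxn (mu i.*2) (mu i.*2.+1)) => u v [k _ ku] [l _ lv].
  exists (maxn k l).*2 => //; apply: tail_sumD.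
    by apply: tail_sumW ku; exact: leq_maxl.
  by apply/tail_sumN; apply: tail_sumW lv; exact: leq_maxr.
Qed.

Definition tail_separated : Prop :=
  forall k g, (forall m, tail_sum (fun=> m) k g) -> g = 0.

(* The finitely many elements of [tail m] outside [tail m'] are dealt with by the
   pigeonhole principle. *)
Lemma tail_sum_closed mu k l g : tail_separated ->
  (forall m, exists2 u, tail_sum mu k u & tail_sum (fun=> m) l (g - u)) ->
  tail_sum mu k g.
Proof.
move=> tail_sep; elim: k l g => [|k IH] l g H.
  by apply: (tail_sep l) => m; have [u ->] := H m; rewrite subr0.
(* First case: the remainder can always absorb the last term of u, at the cost of one more term; the
   induction hypothesis applies with [l.+1]. *)
have [H'|/existsNP[m0 nm0]] := pselect (forall m, exists2 u, tail_sum mu k u &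
    tail_sum (fun=> m) l.+1 (g - u)).
  by exists g; [exact: IH H'|rewrite subrr; exact: tail0].
(* Second case: one fixed last term c serves for all m. *)
pose P c := forall m, exists2 u, tail_sum mu k u & tail_sum (fun=> m) l (g - c - u).
have [[c [tc Pc]]|nP] := pselect (exists c, tail (mu k) c /\ P c).
  by exists (g - c); [exact: IH Pc|rewrite subKr].
exfalso.
have {}nP c : tail (mu k) c -> exists m, forall u, tail_sum mu k u ->
    ~ tail_sum (fun=> m) l (g - c - u).
  move=> tc; apply: contrapT => nm; apply: nP; exists c; split=> // m.
  by apply: contrapT => nu; apply: nm; exists m => u ku lu; apply: nu; exists u.
have /choice[h hP] : forall c, exists m, tail (mu k) c -> forall u,
    tail_sum mu k u -> ~ tail_sum (fun=> m) l (g - c - u).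
  move=> c; have [/nP[m mP]|] := pselect (tail (mu k) c); first by exists m.
  by exists 0%N.
(* [M] is at least [m0] and at least the failure bounds of all [a i] and [- a i] with i < m0. The
   last term u - v is then either in [tail m0], against [nm0], or one of these finitely many
   elements, against [hP]. *)
pose M := maxn m0 (\max_(i < m0) maxn (h (a i)) (h (- a i))).
have [u [v kv uv] lu] := H M.
have uvE : g - (u - v) - v = g - u by rewrite opprB addrAC addrA subrK.
have lM m : (m <= M)%N -> tail_sum (fun=> m) l (g - (u - v) - v).
  by move=> mM; rewrite uvE; exact: tail_sum_le lu.
have low : exists2 i, (i < m0)%N & u - v = a i \/ u - v = - a i.
  apply: contrapT => nlow; apply: nm0; exists v => //.
  exists (g - u); first by rewrite -uvE; apply: lM; exact: leq_maxl.
  rewrite (_ : _ - _ = u - v); last by rewrite opprB addrC addrA subrK.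
  case: uv => [->|[i ki uvi]]; first exact: tail0.
  right; exists i => //; rewrite leqNgt; apply/negP => im.
  by apply: nlow; exists i.
have [i im uvi] := low.
apply: (hP _ uv _ kv); apply: lM; apply: leq_trans (leq_maxr _ _).
apply: leq_trans (leq_bigmax (Ordinal im)) => /=.
by case: uvi => ->; rewrite ?leq_maxl ?leq_maxr.
Qed.

(** A nonzero g is avoided by choosing [mu] recursively: as long as g is not a sum of k terms,
    [tail_sum_closed] with l = 1 gives a bound for the next term that still keeps g out. *)
Lemma tail_sums_separated g : tail_separated -> (forall mu, tail_sums mu g) -> g = 0.
Proof.
move=> tail_sep gU; apply: contrapT => g0.
(* The default 0 of [xget] never occurs along [T]: the proof of [Tg] shows that a suitable m exists
   at each stage. *)
pose next (T : set G) := xget 0%N [set m | ~ exists2 u, T u & tail m (g - u)].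
pose T := fix T k := if k is k.+1 then
  [set v | exists2 u, T k u & tail (next (T k)) (v - u)] else [set 0].
pose mu k := next (T k).
have TE k : tail_sum mu k = T k by elim: k => //= k ->.
have Tg k : ~ T k g.
  elim: k => [//|k IH]; rewrite /=.
  have [m mP] : exists m, ~ exists2 u, T k u & tail m (g - u).
    apply/existsNP => H; apply: IH; rewrite -TE.
    apply: (tail_sum_closed (l := 1)) => // m.
    have [u ku gu] := H m; exists u; first by rewrite TE.
    by exists 0 => //; rewrite subr0.
  exact: (@xgetPex _ 0%N [set m | ~ exists2 u, T k u & tail m (g - u)]
    (ex_intro _ m mP)).
by have [k _] := gU mu; rewrite TE; exact: Tg.
Qed.

Lemma T_sequence_criterion : tail_separated -> T_sequence a.
Proof.
move=> tail_sep.
have [tau tauE] := group_base_topology (fun=> 0%N) tail_sums_base.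
exists tau; last first.
  apply: (group_base_null tauE) => mu; exists (mu 0%N) => //= n mun.
  exists 1%N => //; exists 0 => //; rewrite subr0; right; exists n => //; by left.
(* If the translates of a small set to x and to y meet, then x - y lies in the set of sums for
   [mu]. *)
move=> x y xy; apply: (@subr0_eq G); apply: tail_sums_separated => // mu.
have [_ _ /(_ mu)[nu nuB]] := tail_sums_base.
have nbhsU (w : topgroup tau) : nbhs w [set v : G | tail_sums nu (v - w)].
  by apply/tauE; exists nu => u; rewrite /= addrC addKr.
have [z [/= zx zy]] := xy _ _ (nbhsU x) (nbhsU y).
have -> : (x : G) - y = (z - y) - (z - x) by rewrite opprB [RHS]addrC addrA subrK.
exact: nuB.
Qed.

End Criterion.

(** * Sums of inverse powers of p modulo the integers *)

Lemma natr_expn_divl (F : numFieldType) (p m n : nat) : (0 < p)%N -> (n <= m)%N ->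
  (p ^ m)%N%:R / (p ^ n)%N%:R = (p ^ (m - n))%N%:R :> F.
Proof.
move=> p0 nm; rewrite -{1}(subnK nm) expnD natrM mulfK//.
by rewrite pnatr_eq0 -lt0n expn_gt0 p0.
Qed.

Lemma natr_expn_divr (F : numFieldType) (p m n : nat) : (0 < p)%N -> (m <= n)%N ->
  (p ^ m)%N%:R / (p ^ n)%N%:R = (p ^ (n - m))%N%:R^-1 :> F.
Proof. by move=> p0 nm; rewrite -[LHS]invrK invf_div natr_expn_divl. Qed.

Lemma ler_invn_expn (F : numFieldType) (p m n : nat) : (0 < p)%N -> (m <= n)%N ->
  (p ^ n)%N%:R^-1 <= (p ^ m)%N%:R^-1 :> F.
Proof.
move=> p0 mn; rewrite lef_pV2 ?posrE ?ltr0n ?expn_gt0 ?p0//.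
by rewrite ler_nat leq_pexp2l.
Qed.

Lemma ler_norm_sum_size (F : numDomainType) (T : eqType) (s : seq T) (P : pred T)
    (f : T -> F) (B : F) (k : nat) : 0 <= B -> (size s <= k)%N ->
  (forall t, t \in s -> P t -> `|f t| <= B) -> `|\sum_(t <- s | P t) f t| <= k%:R * B.
Proof.
move=> B0; elim: s k => [|t s IH] k sk fB; first by rewrite big_nil normr0 mulr_ge0.
case: k sk => // k sk.
have {}IH : `|\sum_(t <- s | P t) f t| <= k%:R * B.
  by apply: IH => // u us; apply: fB; rewrite inE us orbT.
rewrite big_cons -natr1 mulrDl mul1r; case: ifP => Pt; last first.
  by rewrite (le_trans IH)// lerDl.
by rewrite addrC (le_trans (ler_normD _ _))// lerD// fB// mem_head.
Qed.

(** The main term has size |c| y, the error is smaller than |c| y, and 2 |c| y < 1; so the sum is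
    nonzero and of absolute value below 1. *)
Lemma perturbed_multiple_nonint (F : archiRealFieldType) (y e1 e2 : F)
    (c : int) (k : nat) :
  c != 0 -> `|c| <= k%:Z -> 0 < y -> y * ((2 * k + 2) ^ 2)%N%:R < 1 ->
  `|e1| <= (2 * k + 1)%N%:R * y ^+ 2 -> `|e2| <= k%:R * y ^+ 2 ->
  (y + e1) *~ c + e2 \isn't a Num.int.
Proof.
move=> c0 ck y0 yk e1k e2k; rewrite -mulrzr.
have [A1 Ak] : 1 <= `|c%:~R : F| /\ `|c%:~R : F| <= k%:R.
  rewrite -intr_norm -[1]/(1%:~R) -[k%:R]/(k%:Z%:~R) !ler_int ck; split=> //.
  by rewrite -gtz0_ge1 normr_gt0.
move: A1 Ak yk e1k e2k; rewrite natrX natrD !natrM.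
set C : F := c%:~R; set K : F := k%:R => A1 AK yk e1k e2k.
have K0 : 0 <= K by exact: ler0n.
set A := `|C| in A1 AK.
have E : `|e1 * C + e2| < A * y.
  apply: le_lt_trans (ler_normD _ _) _; rewrite normrM -/A.
  have : `|e1| * A <= (2 * K + 1) * y ^+ 2 * A by apply: ler_wpM2r; lra.
  have : K * y ^+ 2 <= A * (K * y ^+ 2) by apply: ler_peMl; [nra|].
  have : A * y * (y * (3 * K + 1)) < A * y * 1.
    rewrite ltr_pM2l; last by nra.
    apply: le_lt_trans yk; rewrite ler_pM2l//; nra.
  move: e2k; set a := `|e1| * A; set b := `|e2|; nra.
apply/negP => /norm_intr_ge1 X.
have XE : (y + e1) * C + e2 = y * C + (e1 * C + e2) by rewrite mulrDl addrA.
have yC : `|y * C| = A * y by rewrite normrM gtr0_norm// mulrC.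
have X0 : (y + e1) * C + e2 != 0.
  rewrite XE; apply: contraTneq E => /eqP; rewrite addr_eq0 => /eqP yCE.
  by rewrite -yC yCE normrN ltxx.
have := X X0; apply/negP; rewrite -ltNge XE.
apply: le_lt_trans (ler_normD _ _) _; rewrite yC.
have : A * y <= K * y by rewrite ler_pM2r.
have : K * y * 2 <= y * (2 * K + 2) ^+ 2 by nra.
lra.
Qed.

(** Here c is the total coefficient of b_n, [s] lists the terms e_i with their signs as booleans,
    and [q] stands for all that p^(n^3 - n^2) makes integral. The condition 4k + 4 <= n gives (2k +
    2)^2 < p^n and leaves room for k + 1 windows above n^3 - n^2. *)
Lemma window_nonint (p k n : nat) (c : int) (s : seq (bool * nat)) (q : rat) :
  (1 < p)%N -> c != 0 -> `|c| <= k%:Z -> (size s <= k)%N -> (4 * k + 4 <= n)%N ->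
  (p ^ (n ^ 3 - n ^ 2))%N%:R * q \is a Num.int ->
  q + (\sum_(0 <= j < n.+1) (p ^ (n ^ 3 - j * n))%N%:R^-1) *~ c
    + \sum_(t <- s) (p ^ t.2)%N%:R^-1 *~ (-1) ^+ t.1 \isn't a Num.int.
Proof.
move=> p1 c0 ck sk kn qint; have p0 := ltnW p1.
(* Pigeonhole: k + 1 windows against at most k entries of [s]. Truncated subtraction counts every
   exponent beyond n^3 in window 0, which does no harm. *)
have [j jk js] : exists2 j, (j <= k)%N &
    forall t, t \in s -> ((n ^ 3 - t.2) %/ (2 * n))%N <> j.
  pose w := [seq ((n ^ 3 - t.2) %/ (2 * n))%N | t <- s].
  have [/allP sub|/allPn[j]] := boolP (all (mem w) (iota 0 k.+1)).
    by have := uniq_leq_size (iota_uniq 0 k.+1) sub; rewrite size_iota size_map; lia.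
  rewrite mem_iota => jk /negP jw; exists j; first by lia.
  by move=> t ts tj; apply: jw; apply/mapP; exists t.
(* P is the bottom of the free window j, whose top is P + 2n. *)
pose P := (n ^ 3 - 2 * j.+1 * n)%N.
have jn : (2 * j.+1 * n <= n ^ 2)%N by rewrite leq_mul2r; lia.
have n23 : (n ^ 2 <= n ^ 3)%N by rewrite leq_pexp2l//; lia.
have nP : (n ^ 3 - n ^ 2 <= P)%N by rewrite /P; lia.
pose N : rat := (p ^ P)%N%:R.
have Nle t : (t <= P)%N -> N / (p ^ t)%N%:R \is a Num.int.
  by move=> tP; rewrite /N natr_expn_divl// rpred_nat.
pose y : rat := (p ^ n)%N%:R^-1.
have y0 : 0 < y by rewrite invr_gt0 ltr0n expn_gt0 p0.
have y2 : y ^+ 2 = (p ^ (2 * n))%N%:R^-1 by rewrite exprVn -natrX -expnM mulnC.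
have yk : y * ((2 * k + 2) ^ 2)%N%:R < 1.
  rewrite mulrC ltr_pdivrMr ?mul1r ?ltr_nat ?ltr0n ?expn_gt0 ?p0//.
  apply: leq_trans (leq_pexp2l p0 (_ : ((2 * k + 2) * 2 <= n)%N)); last by lia.
  by rewrite expnM ltn_exp2r// ltn_expl.
have [z1 [e1 [z1int e1y bE]]] : exists z1 e1, [/\ z1 \is a Num.int,
    `|e1| <= (2 * k + 1)%N%:R * y ^+ 2 &
    N * (\sum_(0 <= i < n.+1) (p ^ (n ^ 3 - i * n))%N%:R^-1) = z1 + (y + e1)].
  (* The summands with i >= 2j + 2 become integers, i = 2j + 1 gives exactly y, and those with i <=
     2j are at most y^2 each. *)
  exists (\sum_(2 * j.+1 <= i < n.+1) N / (p ^ (n ^ 3 - i * n))%N%:R).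
  exists (\sum_(0 <= i < (2 * j).+1) N / (p ^ (n ^ 3 - i * n))%N%:R).
  have NU i : (i <= 2 * j.+1)%N ->
      N / (p ^ (n ^ 3 - i * n))%N%:R = (p ^ ((2 * j.+1 - i) * n))%N%:R^-1.
    move=> ij; have ijn : (i * n <= 2 * j.+1 * n)%N by rewrite leq_mul2r ij orbT.
    rewrite /N natr_expn_divr//; last by rewrite /P; lia.
    by congr ((p ^ _)%N%:R^-1); rewrite mulnBl /P; lia.
  split.
  - rewrite big_nat_cond rpred_sum// => i; rewrite andbT => /andP[ji _]; apply: Nle.
    have : (2 * j.+1 * n <= i * n)%N by rewrite leq_mul2r ji orbT.
    by rewrite /P; lia.
  - rewrite big_mkord -(big_mkord xpredT (fun i => N / (p ^ (n ^ 3 - i * n))%N%:R)).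
    apply: ler_norm_sum_size; rewrite ?exprn_ge0 ?(ltW y0)// ?size_iota; first by lia.
    move=> i; rewrite mem_index_iota => /andP[_ ij] _; rewrite NU; last by lia.
    rewrite ger0_norm ?invr_ge0// y2 ler_invn_expn// leq_mul2r; lia.
  - rewrite mulr_sumr (big_cat_nat (n := (2 * j.+1)%N))//=; last by lia.
    rewrite addrC; congr (_ + _); rewrite (_ : (2 * j.+1 = (2 * j).+2)%N); last by lia.
    rewrite big_nat_recr//= addrC; congr (_ + _).
    by rewrite NU; [congr ((p ^ _)%N%:R^-1); lia|lia].
have [z2 [e2 [z2int e2y sE]]] : exists z2 e2, [/\ z2 \is a Num.int,
    `|e2| <= k%:R * y ^+ 2 &
    N * (\sum_(t <- s) (p ^ t.2)%N%:R^-1 *~ (-1) ^+ t.1) = z2 + e2].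
  exists (\sum_(t <- s | (t.2 <= P)%N) N * ((p ^ t.2)%N%:R^-1 *~ (-1) ^+ t.1)).
  exists (\sum_(t <- s | ~~ (t.2 <= P)%N) N * ((p ^ t.2)%N%:R^-1 *~ (-1) ^+ t.1)).
  split; last by rewrite mulr_sumr (bigID (fun t => t.2 <= P)%N).
    by rewrite rpred_sum// => t tP; rewrite mulrzAr rpredMz// Nle.
  apply: ler_norm_sum_size; rewrite ?exprn_ge0 ?(ltW y0)// => t ts; rewrite -ltnNge => Pt.
  rewrite mulrzAr normrMz normrX normrN1 expr1n mulr1z ger0_norm ?divr_ge0//.
  rewrite /N natr_expn_divr// ?(ltnW Pt)// y2 ler_invn_expn//.
  (* An exponent strictly between P and P + 2n would lie in window j. *)
  rewrite leqNgt; apply/negP => tP; apply: (js t ts).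
  have n0 : (0 < 2 * n)%N by lia.
  have arith a m u r w : (0 < r -> m = u + r -> a - m < w -> w - (a - m) < r ->
      m <= a -> a - w < m /\ u <= a - w)%N by lia.
  have jE : (2 * j.+1 * n = j.+1 * (2 * n))%N by rewrite mulnA [(j.+1 * 2)%N]mulnC.
  have [lt ge] : (n ^ 3 - t.2 < j.+1 * (2 * n) /\ j * (2 * n) <= n ^ 3 - t.2)%N.
    apply: arith n0 _ _ _ _; rewrite -?jE//; last exact: leq_trans n23.
    by rewrite jE mulSn addnC.
  by apply/eqP; rewrite eqn_leq leq_divRL// ge andbT -ltnS ltn_divLR.
have qint' : N * q \is a Num.int.
  by rewrite /N -(subnK nP) expnD natrM -mulrA rpredM// rpred_nat.
have Nint : N \is a Num.int by exact: rpred_nat.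
apply/negP => /(rpredM Nint); rewrite !mulrDr mulrzAr bE sE => tot.
apply/negP: (perturbed_multiple_nonint c0 ck y0 yk e1y e2y); apply/negPn.
have -> : (y + e1) *~ c + e2 =
    N * q + (z1 + (y + e1)) *~ c + (z2 + e2) - (N * q + z1 *~ c + z2).
  by rewrite !mulrzDl; ring.
by rewrite rpredB// !rpredD// rpredMz.
Qed.

(** Induction on M, a strict bound for the indices in [s]: the terms of the top index either cancel
    and are dropped, or contradict [window_nonint]. In the lower bound on the indices, 4k + 4 is for
    [window_nonint] and a lets p^(n^3 - n^2) clear the denominators of xi and g. *)
Lemma signed_sum_int (p k a M : nat) (xi g : rat) (s r : seq (bool * nat)) :
  (1 < p)%N -> (p ^ a)%N%:R * xi \is a Num.int -> (p ^ a)%N%:R * g \is a Num.int ->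
  (size s <= k)%N -> (size r <= k)%N ->
  (forall t, t \in s -> 4 * k + 4 + a <= t.2 < M)%N ->
  (forall t, t \in r -> 4 * k + 4 + a <= t.2)%N ->
  - g + \sum_(t <- s)
      (- xi + \sum_(0 <= j < t.2.+1) (p ^ (t.2 ^ 3 - j * t.2))%N%:R^-1) *~ (-1) ^+ t.1
    + \sum_(t <- r) (p ^ t.2)%N%:R^-1 *~ (-1) ^+ t.1 \is a Num.int ->
  g \is a Num.int.
Proof.
move=> p1 xia ga sk rk; have p0 := ltnW p1.
have int_le i j (q : rat) : (i <= j)%N -> (p ^ i)%N%:R * q \is a Num.int ->
    (p ^ j)%N%:R * q \is a Num.int.
  by move=> ij iq; rewrite -(subnK ij) expnD natrM -mulrA rpredM// rpred_nat.
elim: M s sk => [|n IH] s sk sM rm.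
  case: s sk sM => [_ _|t s _ /(_ t)]; last by rewrite mem_head ltn0 andbF => /(_ isT).
  rewrite big_nil addr0; set e := \sum_(t <- r) _ => ge_int.
  (* Only the terms p^-i remain. Their sum e has p^a e integral and |e| <= k / p^(k + a) < p^-a,
     hence e = 0. *)
  have e_small : `|e| <= k%:R / (p ^ (k + a))%N%:R.
    apply: ler_norm_sum_size => // t /rm tm _.
    rewrite normrMz normrX normrN1 expr1n mulr1z ger0_norm ?invr_ge0//.
    by rewrite ler_invn_expn//; apply: leq_trans tm; lia.
  have pe : (p ^ a)%N%:R * e \is a Num.int.
    have -> : (p ^ a)%N%:R * e = (p ^ a)%N%:R * (- g + e) + (p ^ a)%N%:R * g by ring.
    by rewrite rpredD// rpredM// rpred_nat.
  have e0 : e = 0.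
    have pa0 : 0 < (p ^ a)%N%:R :> rat by rewrite ltr0n expn_gt0 p0.
    apply/eqP; apply: contraT => e0.
    have := norm_intr_ge1 pe (mulf_neq0 (lt0r_neq0 pa0) e0).
    rewrite normrM gtr0_norm// leNgt => /negP[].
    apply: (@le_lt_trans _ _ (k%:R / (p ^ k)%N%:R)).
      rewrite -ler_pdivlMl//; apply: le_trans e_small _.
      by rewrite expnD natrM invfM mulrA [leRHS]mulrC.
    rewrite ltr_pdivrMr; last by rewrite ltr0n expn_gt0 p0.
    by rewrite mul1r ltr_nat; exact: ltn_expl.
  by move: ge_int; rewrite e0 addr0 rpredN.
set F := fun n => - xi + \sum_(0 <= j < n.+1) (p ^ (n ^ 3 - j * n))%N%:R^-1.
pose c : int := \sum_(t <- s | t.2 == n) (-1) ^+ t.1.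
pose s' := [seq t <- s | t.2 != n].
have s'P t : t \in s' -> (4 * k + 4 + a <= t.2 < n)%N.
  by rewrite mem_filter => /andP[tn /sM/andP[-> tM]]; rewrite ltn_neqAle tn.
have s'k : (size s' <= k)%N by apply: leq_trans sk; rewrite size_filter count_size.
have -> : \sum_(t <- s) F t.2 *~ (-1) ^+ t.1
    = F n *~ c + \sum_(t <- s') F t.2 *~ (-1) ^+ t.1.
  rewrite (bigID (fun t => t.2 == n))/= big_filter; congr (_ + _).
  rewrite mulrz_sumr; apply: eq_bigr => t /eqP -> //.
have [->|c0] := eqVneq c 0; first by rewrite mulr0z add0r; exact: IH.
have nm : (4 * k + 4 + a <= n)%N.
  have [/hasP[t ts /eqP tn]|/hasPn ns] := boolP (has (fun t => t.2 == n) s).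
    by have := sM _ ts; rewrite tn => /andP[].
  move: c0; rewrite /c big1_seq ?eqxx// => t /andP[tn /ns].
  by rewrite tn.
have ck : `|c| <= k%:Z.
  have := @ler_norm_sum_size int _ s (fun t => t.2 == n) (fun t => (-1) ^+ t.1) 1 k.
  rewrite mulr1 natz; apply=> // t _ _.
  by rewrite normrX normrN1 expr1n.
have n32 : (n ^ 3 - n ^ 2 = n ^ 2 * n.-1)%N by nia.
pose q := - g + (- xi) *~ c + \sum_(t <- s') F t.2 *~ (-1) ^+ t.1.
(* The exponents in b_t with t < n are at most t^3 <= n^2 (n - 1) = n^3 - n^2. *)
have qint : (p ^ (n ^ 3 - n ^ 2))%N%:R * q \is a Num.int.
  have an : (a <= n ^ 3 - n ^ 2)%N by nia.
  have xin := int_le _ _ _ an xia; have gn := int_le _ _ _ an ga.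
  rewrite /q !mulrDr mulrzAr !mulrN !rpredD ?rpredMz ?rpredN//.
  rewrite mulr_sumr big_seq_cond rpred_sum// => t; rewrite andbT => /s'P/andP[_ tn].
  rewrite mulrzAr rpredMz// mulrDr mulrN rpredD ?rpredN//.
  rewrite mulr_sumr rpred_sum// => j _.
  rewrite natr_expn_divl ?rpred_nat//; apply: leq_trans (leq_subr _ _) _.
  rewrite n32 expnSr leq_mul ?leq_exp2r ?(ltnW tn)//.
  by rewrite -ltnS prednK// (leq_ltn_trans _ tn).
have nk : (4 * k + 4 <= n)%N by lia.
move=> tot; have := window_nonint p1 c0 ck rk nk qint => /negP[].
by move: tot; rewrite /q /F mulrzDl -!addrA; congr (is_true (_ \is a _)); ring.
Qed.

(** * From sums in the Prüfer group to sums of rationals *)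

Lemma pruefer_mulrn_eq0 (p : nat) (y : pruefer p) (q : rat) (n : nat) :
  val y = \pi_(modZ rat) q -> (y *+ n == 0) = (n%:R * q \is a Num.int).
Proof.
move=> yq; rewrite -modZ_eq0 mulr_natl raddfMn /= -yq -(raddfMn val).
by rewrite -val_eqE (raddf0 val).
Qed.

(** The boolean records a sign. The bound is doubled because the entry of index n in [d_seq] comes
    from b or e at index [n./2.+1]. *)
Lemma tail_sum_d_seq (p : nat) (x : pruefer p) (m k : nat) (g : pruefer p) :
  tail_sum (d_seq x) (fun=> m.*2) k g ->
  exists s r : seq (bool * nat), [/\ (size s <= k)%N, (size r <= k)%N,
    forall t, t \in s -> (m <= t.2)%N, forall t, t \in r -> (m <= t.2)%N &
    g = \sum_(t <- s) b_seq x t.2 *~ (-1) ^+ t.1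
      + \sum_(t <- r) pruefer_gen p t.2 *~ (-1) ^+ t.1].
Proof.
elim: k g => [|k IH] g; first by move=> ->; exists [::], [::]; rewrite !big_nil addr0.
move=> [u /IH[s [r [sk rk sm rm uE]]] [/subr0_eq->|[n nm gu]]].
  by exists s, r; split=> //; rewrite leqW.
have {}gu : exists b : bool, g = u + d_seq x n *~ (-1) ^+ b.
  by case: gu => gu; [exists false|exists true]; rewrite ?mulr1z ?mulrN1z -gu addrC subrK.
move: gu => [b ->]; rewrite /d_seq.
have mn : (m <= n./2.+1)%N by lia.
have cons_m v : (forall t, t \in v -> (m <= t.2)%N) ->
    forall t, t \in (b, n./2.+1) :: v -> (m <= t.2)%N.
  by move=> vm t; rewrite inE => /predU1P[->//|/vm].
case: ifP => _.
  exists s, ((b, n./2.+1) :: r); split => //; [by rewrite leqW|exact: cons_m|].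
  by rewrite big_cons uE /= -addrA; congr (_ + _); rewrite addrC.
exists ((b, n./2.+1) :: s), r; split => //; [by rewrite leqW|exact: cons_m|].
by rewrite big_cons uE /= addrC addrA.
Qed.

Lemma d_seq_tail_separated (p : nat) (x : pruefer p) :
  prime p -> tail_separated (d_seq x).
Proof.
move=> /prime_gt1 p1 k g gm.
pose xi := repr (val x); pose ga := repr (val g).
have liftx : val x = \pi_(modZ rat) xi by rewrite reprK.
have liftg : val g = \pi_(modZ rat) ga by rewrite reprK.
have [n1 /eqP xn1] := pruefer_torsion x.
have [n2 /eqP gn2] := pruefer_torsion g.
pose a := (n1 + n2)%N.
have xia : (p ^ a)%N%:R * xi \is a Num.int.
  by rewrite -(pruefer_mulrn_eq0 _ liftx) expnD mulrnA xn1 mul0rn.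
have gaa : (p ^ a)%N%:R * ga \is a Num.int.
  by rewrite -(pruefer_mulrn_eq0 _ liftg) expnD mulnC mulrnA gn2 mul0rn.
have [s [r [sk rk sm rm gE]]] := tail_sum_d_seq (gm (4 * k + 4 + a).*2).
(* The sum of all indices plus one is a crude strict bound for each of them. *)
pose M := (sumn (map snd s)).+1.
have sM t : t \in s -> (4 * k + 4 + a <= t.2 < M)%N.
  move=> ts; rewrite sm//= /M ltnS sumnE big_map.
  by rewrite (big_rem t ts)/= leq_addr.
apply/val_inj/eqP; rewrite [val g]liftg modZ_eq0.
apply: (signed_sum_int p1 xia gaa sk rk sM rm).
have val_sum I (v : seq I) (f : I -> pruefer p) (q : I -> rat) :
    (forall i, val (f i) = \pi_(modZ rat) (q i)) ->
    val (\sum_(i <- v) f i) = \pi_(modZ rat) (\sum_(i <- v) q i).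
  by move=> fq; rewrite raddf_sum [RHS]raddf_sum; apply: eq_bigr => i _; exact: fq.
have val_Mz (y : pruefer p) q (n : int) : val y = \pi_(modZ rat) q ->
    val (y *~ n) = \pi_(modZ rat) (q *~ n).
  by move=> yq; rewrite !raddfMz /= yq.
have val_b n : val (b_seq x n) =
    \pi_(modZ rat) (- xi + \sum_(0 <= j < n.+1) (p ^ (n ^ 3 - j * n))%N%:R^-1).
  rewrite raddfD [RHS]raddfD !raddfN; congr (- _ + _); first exact: liftx.
  by apply: val_sum.
rewrite -modZ_eq0 -addrA addrC raddfB subr_eq0; apply/eqP; rewrite -[RHS]liftg gE.
rewrite raddfD [RHS]raddfD; apply/esym; congr (_ + _).
  by apply: val_sum => t; exact: val_Mz.
by apply: val_sum => t; exact: val_Mz.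
Qed.

(** * Neighbourhoods of 0 in the circle and continuity of characters *)

Definition circle_ball (R : realType) (e : R) : set (circle R) :=
  [set z | exists2 t : R, `|t| < e & z = \pi_(modZ R) t].

(** In the quotient topology, openness of the ball is openness of its preimage in R; around a point
    r whose class has the lift t, radius e - |t| works. *)
Lemma nbhs_circle_ball (R : realType) (e : R) : 0 < e ->
  nbhs (0 : circle R) (circle_ball e).
Proof.
move=> e0; apply: open_nbhs_nbhs; split; last first.
  by exists 0; rewrite ?normr0// raddf0.
suff : open [set r : R | circle_ball e (\pi_(modZ R) r)] by [].
rewrite openE => r [t te rt]; apply/nbhs_ballP.
exists (e - `|t|) => /= [|s]; first by rewrite subr_gt0.
rewrite /ball/= distrC => sr; exists (t + (s - r)).
  by rewrite (le_lt_trans (ler_normD _ _))//; lra.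
by rewrite raddfD raddfB /= -rt subrKC.
Qed.

Lemma open_circle_ball (R : realType) (U : set (circle R)) (r : R) :
  open U -> U (\pi_(modZ R) r) ->
  exists2 e : R, 0 < e & forall z, circle_ball e z -> U (\pi_(modZ R) r + z).
Proof.
move=> oU Ur; have : open [set s : R | U (\pi_(modZ R) s)] by exact: oU.
rewrite openE => /(_ r Ur)/nbhs_ballP[e /= e0 eU]; exists e => // z [t te ->].
rewrite -raddfD; apply: eU => /=.
by rewrite /ball/= opprD addNKr normrN.
Qed.

Lemma circle_ballB (R : realType) (e : R) (z w : circle R) :
  circle_ball e z -> circle_ball e w -> circle_ball (e + e) (z - w).
Proof.
move=> [t te ->] [s se ->]; exists (t - s); last by rewrite raddfB.
by rewrite (le_lt_trans (ler_normB _ _))// ltrD.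
Qed.

(** For the converse, the preimages of balls under chi are a base for a group topology in which d
    tends to 0. Preimages of open sets are open for it, hence for the finest topology. *)
Lemma dual_finestP (R : realType) (G : zmodType) (d : nat -> G) (chi : G -> circle R) :
  dual R (finest_topgroup d) chi <-> zmod_morphism chi /\
    forall e : R, 0 < e -> \forall n \near \oo, circle_ball e (chi (d n)).
Proof.
split=> [[chiB chi_cont]|[chiB chid]]; split=> //.
  move=> e /nbhs_circle_ball e0.
  have chi0 : chi 0 = 0 by have := chiB 0 0; rewrite !subrr.
  have := @finest_null_sequence G d; rewrite /null_sequence => d0.
  apply: (d0 [set x | circle_ball e (chi x)]).
  by apply: (chi_cont 0); rewrite chi0.
have base : group_base (fun e : {posnum R} => [set x | circle_ball e%:num (chi x)]).
  have chi0 : chi 0 = 0 by have := chiB 0 0; rewrite !subrr.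
  split=> [e|e f|e].
  - by exists 0; rewrite ?normr0// chi0 raddf0.
  - exists (Num.min e%:num f%:num)%:pos => x [t] /=; rewrite lt_min => /andP[te tf] xt.
    by split; exists t.
  - exists (e%:num / 2)%:pos => u v /= ue ve; rewrite chiB [e%:num]splitr.
    exact: circle_ballB.
have [tau tauE] := group_base_topology 1%:pos base.
apply/continuousP => U oU.
have taud : null_sequence tau d.
  by apply: (group_base_null tauE) => e; exact: chid.
apply: (finest_group_topology_finest taud).
suff : @open (topgroup tau) (chi @^-1` U) by [].
rewrite openE => x Ux; apply/tauE.
have [e e0 eU] : exists2 e : R, 0 < e & forall z, circle_ball e z -> U (chi x + z).
  by rewrite -[chi x]reprK; apply: open_circle_ball => //; rewrite reprK.
exists (PosNum e0) => u /= /eU.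
suff -> : chi ((x : G) + u) = chi x + chi u by [].
have := chiB ((x : G) + u) u; rewrite addrK => ->.
by rewrite subrK.
Qed.

(** * Characters that tend to 0 along the e_n *)

Lemma zmod_morphismMz (G H : zmodType) (f : G -> H) : zmod_morphism f ->
  forall (x : G) (n : int), f (x *~ n) = f x *~ n.
Proof.
move=> fB x n; pose g : {additive G -> H} :=
  HB.pack f (GRing.isZmodMorphism.Build G H f fB).
exact: (raddfMz g).
Qed.

Lemma zmod_morphism0 (G H : zmodType) (f : G -> H) : zmod_morphism f -> f 0 = 0.
Proof. by move=> fB; have := fB 0 0; rewrite !subrr. Qed.

Lemma natural_char_inj (R : realType) (p : nat) (y : pruefer p) :
  natural_char R y = 0 -> y = 0.
Proof.
move=> y0; have : \pi_(modZ R) (ratr (repr (val y))) == 0 by exact/eqP.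
rewrite modZ_eq0 => /intrP[m ym].
have : \pi_(modZ rat) (repr (val y)) == 0.
  rewrite modZ_eq0; apply/intrP; exists m.
  by apply: (fmorph_inj (@ratr R)); rewrite [RHS]ratr_int; exact: ym.
by rewrite reprK => /eqP ?; apply: val_inj.
Qed.

Lemma natural_char_gen (R : realType) (p n : nat) :
  natural_char R (pruefer_gen p n) = \pi_(modZ R) (p ^ n)%N%:R^-1.
Proof. by rewrite (natural_charE R (q := (p ^ n)%N%:R^-1))// fmorphV /= ratr_nat. Qed.

Lemma pruefer_gen_mulrn (p m n : nat) : (0 < p)%N -> (m <= n)%N ->
  pruefer_gen p n *+ (p ^ m)%N = pruefer_gen p (n - m).
Proof.
move=> p0 mn; apply/val_inj; rewrite raddfMn /= -raddfMn; congr (\pi_(modZ rat) _).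
by rewrite -[LHS]mulr_natl natr_expn_divr.
Qed.

Lemma pruefer_gen0 (p : nat) : pruefer_gen p 0 = 0.
Proof.
have : \pi_(modZ rat) (p ^ 0)%N%:R^-1 == 0 by rewrite modZ_eq0 expn0 invr1 rpred1.
by move=> /eqP ?; apply: val_inj.
Qed.

Lemma pruefer_gen_span (p n : nat) (y : pruefer p) : (0 < p)%N ->
  y *+ (p ^ n)%N = 0 -> exists z : int, y = pruefer_gen p n *~ z.
Proof.
move=> p0 /eqP; rewrite (pruefer_mulrn_eq0 _ (esym (reprK (val y)))) => /intrP[z yz].
exists z; apply/val_inj; rewrite raddfMz /= -raddfMz -[LHS]reprK.
congr (\pi_(modZ rat) _); rewrite -mulrzr -yz mulrA mulVf ?mul1r//.
by rewrite pnatr_eq0 -lt0n expn_gt0 p0.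
Qed.

(* Near 0 the circle has unique small lifts: once the lifts t_n of the values at
   e_n are small enough, p t_(n+1) - t_n is an integer of absolute value < 1. *)
Lemma null_on_gen (R : realType) (p : nat) (chi : pruefer p -> circle R) :
  (0 < p)%N -> zmod_morphism chi ->
  (forall e : R, 0 < e -> \forall n \near \oo, circle_ball e (chi (pruefer_gen p n))) ->
  exists m : int, chi = (fun y => natural_char R y *~ m).
Proof.
move=> p0 chiB chie; have chiMz := zmod_morphismMz chiB.
have chi0 := zmod_morphism0 chiB.
(* This radius makes |t_i| + p |t_(i+1)| smaller than (p + 1) / (p + 2) < 1. *)
have e0 : 0 < (p.+2%:R : R)^-1 by rewrite invr_gt0.
have [N _ NP] := chie _ e0.
have /choice[t tP] : forall i, exists t : R, `|t| < p.+2%:R^-1 /\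
    chi (pruefer_gen p (N + i)) = \pi_(modZ R) t.
  by move=> i; have [t te tE] := NP (N + i)%N (leq_addr _ _); exists t.
have pn0 n : (p ^ n)%N%:R != 0 :> R by rewrite pnatr_eq0 -lt0n expn_gt0 p0.
have tS i : t i = p%:R * t i.+1.
  have : t i - p%:R * t i.+1 \is a Num.int.
    have [[_ ti] [_ ti1]] := (tP i, tP i.+1).
    rewrite -modZ_eq0 mulr_natl raddfB raddfMn /= -[X in X - _]ti -[X in _ - X *+ _]ti1.
    rewrite -[X in _ - X](chiMz _ p%:Z) -pmulrn -[X in _ *+ X]expn1 pruefer_gen_mulrn//.
      by rewrite addnS subn1 /= subrr.
    by rewrite addnS.
  move=> /norm_intr_ge1 ge1; apply/eqP; rewrite -subr_eq0; apply: contraT => /ge1.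
  rewrite leNgt => /negP[]; apply: le_lt_trans (ler_normB _ _) _.
  have [[ti _] [ti1 _]] := (tP i, tP i.+1).
  rewrite normrM normr_nat.
  have p0' : 0 < p%:R :> R by rewrite ltr0n.
  have pt : p%:R * `|t i.+1| < p%:R * p.+2%:R^-1 by rewrite ltr_pM2l.
  apply: lt_le_trans (ltrD ti pt) _.
  rewrite -[X in X + _]mul1r -mulrDl ler_pdivrMr// mul1r -!natr1; lra.
have tE i : t 0%N = (p ^ i)%N%:R * t i.
  by elim: i => [|i IH]; rewrite ?expn0 ?mul1r// IH tS expnSr natrM mulrA.
(* p^N kills chi(e_N), so p^N t_0 is an integer m; by [tE], t_n = m / p^(N + n), which is a lift of
   m chi_1(e_(N + n)). *)
have [m mE] : exists m : int, (p ^ N)%N%:R * t 0%N = m%:~R.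
  apply/intrP; rewrite -modZ_eq0 mulr_natl raddfMn /=.
  have [_ t0] := tP 0%N; rewrite addn0 in t0; rewrite -[X in X *+ _]t0.
  rewrite -[X in X == _](chiMz _ (p ^ N)%N%:Z) -pmulrn pruefer_gen_mulrn// subnn.
  by rewrite pruefer_gen0 chi0.
exists m; apply/funext => y; have [n /eqP yn] := pruefer_torsion y.
(* The generator e_(N + n) replaces e_n because small lifts are only available from index N on. *)
have [z ->] : exists z : int, y = pruefer_gen p (N + n) *~ z.
  by apply: pruefer_gen_span => //; rewrite expnD mulnC mulrnA yn mul0rn.
rewrite chiMz (zmod_morphismMz (@natural_char_additive R p)) mulrzAC; congr (_ *~ z).
have [_ ->] := tP n; rewrite natural_char_gen -[RHS](raddfMz \pi_(modZ R)).
congr (\pi_(modZ R) _); rewrite -mulrzr -mE (tE n) expnD natrM.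
by rewrite invfM [(p ^ N)%N%:R * _]mulrA mulrACA ?mulrA; field; rewrite !pn0.
Qed.

(** * The character group of the finest topology *)

Lemma d_seq_near (p : nat) (x : pruefer p) (P : set (pruefer p)) :
  (\forall k \near \oo, P (d_seq x k)) <->
  (\forall n \near \oo, P (b_seq x n)) /\ (\forall n \near \oo, P (pruefer_gen p n)).
Proof.
split=> [[N _ NP]|[[N _ NP] [M _ MP]]].
  split; exists N.+1 => //= -[//|n] /= Nn.
    have /= := NP n.*2; rewrite /d_seq odd_double doubleK; apply.
    by rewrite -addnn; apply: leq_trans (leq_addr _ _).
  have /= := NP n.*2.+1; rewrite /d_seq /= odd_double /= uphalf_double; apply.
  by rewrite -addnn; apply: leqW; apply: leq_trans (leq_addr _ _).
exists (N + M).*2 => //= k kNM.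
have {}kNM : (N + M <= k./2)%N by rewrite -[(N + M)%N]doubleK half_leq.
rewrite /d_seq; case: ifP => _; [apply: MP|apply: NP] => /=; lia.
Qed.

Lemma ltr_invn_near (R : realType) (a e : R) : 0 <= a -> 0 < e ->
  \forall n \near \oo, a / n.+1%:R < e.
Proof.
move=> a0 e0; have a1 : 0 < a + 1 by rewrite ltr_wpDl.
have := near_infty_natSinv_lt (PosNum (divr_gt0 e0 a1)).
apply: filterS => n /=; rewrite ltr_pdivlMr// mulrDr mulr1 mulrC => lt_e.
by apply: le_lt_trans lt_e; rewrite lerDl invr_ge0.
Qed.

(** Each of the n + 1 summands is at most p^(-2n) once n >= 2, and p^n >= n + 1 bounds their sum by
    1 / (n + 1). *)
Lemma sum_gen_near (R : realType) (p : nat) (m : int) (e : R) : (1 < p)%N -> 0 < e ->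
  \forall n \near \oo, circle_ball e
    (natural_char R (\sum_(0 <= j < n.+1) pruefer_gen p (n ^ 3 - j * n)) *~ m).
Proof.
move=> p1 e0; have p0 := ltnW p1.
have m0 : 0 <= `|m|%:~R :> R by rewrite ler0z.
have [N _ NP] := ltr_invn_near m0 e0.
exists (maxn N 2) => // n /=; rewrite geq_max => /andP[/NP /= ne n2].
pose u j : R := (p ^ (n ^ 3 - j * n))%N%:R^-1.
exists ((\sum_(0 <= j < n.+1) u j) *~ m); last first.
  rewrite raddfMz; congr (_ *~ m); rewrite raddf_sum /=.
  transitivity (\sum_(0 <= j < n.+1) natural_char R (pruefer_gen p (n ^ 3 - j * n))).
    pose f : {additive pruefer p -> circle R} := HB.pack (@natural_char R p)
      (GRing.isZmodMorphism.Build _ (circle R) _ (@natural_char_additive R p)).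
    exact: (raddf_sum f).
  by apply: eq_bigr => j _; exact: natural_char_gen.
have small : `|\sum_(0 <= j < n.+1) u j| <= n.+1%:R^-1.
  have : `|\sum_(0 <= j < n.+1) u j| <= n.+1%:R * (p ^ (2 * n))%N%:R^-1.
    apply: ler_norm_sum_size; rewrite ?size_iota ?subn0// => j.
    rewrite mem_index_iota => /andP[_ jn] _; rewrite ger0_norm ?invr_ge0//.
    apply: ler_invn_expn => //.
    have : (j * n <= n ^ 2)%N by rewrite -mulnn leq_mul2r -[(j <= n)%N]ltnS jn orbT.
    nia.
  move=> /le_trans; apply.
  rewrite ler_pdivrMr ?ltr0n ?expn_gt0 ?p0// mulrC ler_pdivlMr//.
  by rewrite -natrM ler_nat mul2n -addnn expnD leq_mul// ltn_expl.
rewrite normrMz -mulrzr (le_lt_trans (ler_wpM2r m0 small))// mulrC; exact: ne.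
Qed.

Lemma natural_char_near (R : realType) (p : nat) (m : int) (e : R) : (1 < p)%N -> 0 < e ->
  \forall n \near \oo, circle_ball e (natural_char R (pruefer_gen p n) *~ m).
Proof.
move=> p1 e0; have p0 := ltnW p1.
have m0 : 0 <= `|m|%:~R :> R by rewrite ler0z.
have := ltr_invn_near m0 e0; apply: filterS => n; move=> ne.
exists ((p ^ n)%N%:R^-1 *~ m); last by rewrite natural_char_gen raddfMz.
rewrite normrMz -mulrzr mulrC; apply: le_lt_trans ne.
rewrite ler_wpM2l// ger0_norm ?invr_ge0//.
by rewrite lef_pV2 ?posrE ?ltr0n ?expn_gt0 ?p0// ler_nat ltn_expl.
Qed.

(** A lift t with |t| < 1 / n and n t an integer must be 0. *)
Lemma circle_torsion_small (R : realType) (z : circle R) (n : nat) : (0 < n)%N ->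
  z *+ n = 0 -> (forall e : R, 0 < e -> circle_ball e z) -> z = 0.
Proof.
move=> n0 zn zsmall; have nR : 0 < n%:R :> R by rewrite ltr0n.
have [t tn zt] := zsmall n%:R^-1 (ltac:(by rewrite invr_gt0)).
have : n%:R * t \is a Num.int.
  rewrite -modZ_eq0 mulr_natl raddfMn /= -[X in X *+ _]zt; exact/eqP.
move=> /norm_intr_ge1 nt; rewrite zt.
suff -> : t = 0 by rewrite raddf0.
apply/eqP; apply: contraT => t0.
have := nt (mulf_neq0 (lt0r_neq0 nR) t0).
rewrite normrM gtr0_norm// leNgt mulrC -ltr_pdivlMr// mul1r tn => //.
Qed.

Lemma dual_d_seqP (R : realType) (p : nat) (x : pruefer p) (chi : pruefer p -> circle R) :
  prime p ->
  dual R (finest_topgroup (d_seq x)) chi <->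
  exists2 m : int, x *~ m = 0 & chi = (fun y => natural_char R y *~ m).
Proof.
move=> p_pr; have p1 := prime_gt1 p_pr; have p0 := prime_gt0 p_pr.
have natMz := zmod_morphismMz (@natural_char_additive R p).
split=> [/dual_finestP[chiB chid]|[m xm chiE]].
  have [m chiE] : exists m : int, chi = (fun y => natural_char R y *~ m).
    apply: null_on_gen => // e e0.
    by have /(d_seq_near x (fun y => circle_ball e (chi y)))[] := chid e e0.
  exists m => //; apply: (@natural_char_inj R); rewrite natMz.
  have [n /eqP xn] := pruefer_torsion x.
  apply: (@circle_torsion_small _ _ (p ^ n)%N); rewrite ?expn_gt0 ?p0//.
    by rewrite pmulrn mulrzAC -pmulrn -[X in X *~ m](natMz x (p ^ n)%N%:Z) -pmulrn xn
      (zmod_morphism0 (@natural_char_additive R p)) mul0rz.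
  (* The values of chi at b_n + x and at b_n are both small, and their difference m chi_1(x) does
     not depend on n: one large n is enough for each e. *)
  move=> e e0; have e20 : 0 < e / 2 by rewrite divr_gt0.
  have [N _ NP] : \forall n \near \oo, circle_ball (e / 2) (chi (b_seq x n)) /\
     circle_ball (e / 2)
    (natural_char R (\sum_(0 <= j < n.+1) pruefer_gen p (n ^ 3 - j * n)) *~ m).
    apply: filterI; last exact: sum_gen_near.
    by have /(d_seq_near x (fun y => circle_ball (e / 2) (chi y)))[] := chid _ e20.
  have [bN sN] := NP N (leqnn N).
  have := circle_ballB sN bN; rewrite -splitr.
  rewrite chiE -mulrzBl -[X in circle_ball _ (X *~ _)]natural_char_additive.
  by rewrite /b_seq opprD opprK addrCA subrr addr0.
apply/dual_finestP; split.
  move=> y z; rewrite chiE -mulrzBl; congr (_ *~ m); exact: natural_char_additive.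
move=> e e0; apply/(d_seq_near x (fun y => circle_ball e (chi y))); rewrite chiE.
split; last exact: natural_char_near.
(* As m x = 0, the multiples by m of b_n and of b_n + x agree. *)
have := sum_gen_near m p1 e0; apply: filterS => n.
by rewrite -!natMz /b_seq mulrzDl mulNrz xm oppr0 add0r.
Qed.

(** * Orders and cyclic subgroups *)

Lemma mulrz_modz (G : zmodType) (x : G) (n : nat) (m : int) :
  x *+ n = 0 -> x *~ (m %% n)%Z = x *~ m.
Proof.
move=> xn; have := divz_eq m n; move: (m %/ n)%Z (m %% n)%Z => a b ->.
by rewrite mulrzDr [a * _]mulrC mulrzA -pmulrn xn mul0rz add0r.
Qed.

Lemma has_order_mulrz_eq0 (G : zmodType) (x : G) (n : nat) (m : int) :
  has_order x n -> x *~ m = 0 -> (n %| m)%Z.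
Proof.
move=> [n0 xn n_min] xm; have nZ : n%:Z != 0 by rewrite eqz_nat -lt0n.
apply/dvdz_mod0P; have r0 := modz_ge0 m nZ.
have xr : x *~ (m %% n)%Z = 0 by rewrite mulrz_modz.
have rn : (m %% n)%Z < n by rewrite ltz_pmod.
case: (m %% n)%Z r0 xr rn => [[|r]|r] // _ xr rn.
by have := n_min r.+1 isT xr; rewrite leqNgt -ltz_nat rn.
Qed.

(** All elements killed by p^n are multiples of e_n. If x = u e_n has order p^n with n > 0, then p
    does not divide u, and a Bezout relation inverts u modulo p^n. *)
Lemma pruefer_torsion_cyclic (p : nat) (x y : pruefer p) (n : nat) : prime p ->
  has_order x (p ^ n)%N -> y *+ (p ^ n)%N = 0 -> exists m : int, y = x *~ m.
Proof.
move=> p_pr [_ xn x_min] yn; have p0 := prime_gt0 p_pr.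
have [u xu] := pruefer_gen_span p0 xn; have [v yv] := pruefer_gen_span p0 yn.
have [n_eq0|n_gt0] := posnP n.
  by exists 0; rewrite yv n_eq0 pruefer_gen0 mul0rz mulr0z.
have cop : coprimez u (p ^ n)%N%:Z.
  rewrite /coprimez /gcdz /= -[_ == _]/(coprime _ _) coprimeXr// coprime_sym.
  rewrite prime_coprime//; apply/negP => /dvdnP[w uw].
  (* If p divided u, already p^(n - 1) would kill x. *)
  have := x_min (p ^ n.-1)%N; rewrite expn_gt0 p0 => /(_ isT).
  rewrite leqNgt ltn_exp2l ?prime_gt1// prednK// leqnn => H.
  suff /H : x *+ (p ^ n.-1)%N = 0 by [].
  have gen0 : pruefer_gen p n *+ (p ^ n)%N = 0.
    by rewrite pruefer_gen_mulrn// subnn pruefer_gen0.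
  have abs0 : pruefer_gen p n *+ `|u|%N *+ (p ^ n.-1)%N = 0.
    by rewrite uw -mulrnA -mulnA -expnS prednK// mulnC mulrnA gen0 mul0rn.
  move: abs0; rewrite xu; case: (u) => k //=; rewrite NegzE /= => abs0.
  by rewrite mulrNz -pmulrn mulNrn abs0 oppr0.
have [w [z]] := Bezoutz u (p ^ n)%N%:Z; rewrite (eqP cop) => wz.
exists (w * v); rewrite yv xu -mulrzA.
have -> : u * (w * v) = v - z * v * (p ^ n)%N%:Z.
  by rewrite -[X in X - _]mul1r -wz; ring.
rewrite mulrzBr [X in _ - X](_ : _ = 0) ?subr0// mulrC mulrzA -pmulrn.
by rewrite pruefer_gen_mulrn// subnn pruefer_gen0 mul0rz.
Qed.

(** * The dual, the radical and its finiteness *)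

Theorem theorem4p4 (R : realType) (p : nat) (p_prime : prime p) (p_neq2 : p <> 2%N)
    (x : pruefer p) (x_neq0 : x <> 0) (n0 : nat)
    (order_x : has_order x (p ^ n0)%N) :
  let d := d_seq x in
  let Gd : topologicalZmodType := finest_topgroup d in
  [/\ T_sequence d,
      dual R Gd = padic_char R @`
        [set padic_of_int p_prime ((p ^ n0)%N%:Z * m) | m in [set: int]],
      von_neumann_radical R Gd = [set x *~ m | m in [set: int]] &
      [/\ ~ maximally_almost_periodic R Gd,
          ~ minimally_almost_periodic R Gd &
          finite_set (von_neumann_radical R Gd)]].
Proof.
move=> d Gd; have p0 := prime_gt0 p_prime; have p1 := prime_gt1 p_prime.
have [q0 xq x_min] := order_x.
have natB := @natural_char_additive R p; have natMz := zmod_morphismMz natB.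
have dualE : dual R Gd = padic_char R @`
    [set padic_of_int p_prime ((p ^ n0)%N%:Z * m) | m in [set: int]].
  apply/seteqP; split=> chi.
    move=> /(dual_d_seqP x _ p_prime)[m /(has_order_mulrz_eq0 order_x)/dvdzP[k mE] ->].
    exists (padic_of_int p_prime ((p ^ n0)%N%:Z * k)); first by exists k.
    by rewrite padic_char_int mE mulrC.
  move=> [_ [m _ <-] <-]; apply/(dual_d_seqP x _ p_prime).
  exists ((p ^ n0)%N%:Z * m); last exact: padic_char_int.
  by rewrite mulrzA -pmulrn xq mul0rz.
have radE : von_neumann_radical R Gd = [set x *~ m | m in [set: int]].
  apply/seteqP; split=> y.
    move=> yrad; have [m ->] : exists m : int, y = x *~ m; last by exists m.
    apply: (pruefer_torsion_cyclic p_prime order_x).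
    (* This continuous character has the p^n0-torsion as its kernel, and that torsion is generated
       by x. *)
    have chi1 : dual R Gd (fun z => natural_char R z *~ (p ^ n0)%N%:Z).
      by apply/(dual_d_seqP x _ p_prime); exists (p ^ n0)%N%:Z; rewrite // -pmulrn.
    by apply: (@natural_char_inj R); rewrite pmulrn natMz; exact: (yrad _ chi1).
  move=> [m _ <-] chi /(dual_d_seqP x _ p_prime)[k xk ->] /=.
  by rewrite -natMz mulrzAC xk mul0rz (zmod_morphism0 natB).
split=> //.
  by apply: T_sequence_criterion; exact: d_seq_tail_separated.
split.
- rewrite /maximally_almost_periodic radE => /seteqP[sub _].
  by apply: x_neq0; apply: (sub x); exists 1.
- rewrite /minimally_almost_periodic radE => /seteqP[_ sub].
  (* p^n0 kills every multiple of x but sends e_(n0 + 1) to e_1, which is nonzero since 1 / p is not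
     an integer. *)
  have [m _ mE] := sub (pruefer_gen p n0.+1) I.
  have : pruefer_gen p n0.+1 *+ (p ^ n0)%N = 0.
    by rewrite -mE pmulrn mulrzAC -pmulrn xq mul0rz.
  rewrite pruefer_gen_mulrn// subSnn => /(congr1 (natural_char R)).
  rewrite natural_char_gen (zmod_morphism0 natB) expn1 => pi0.
  have : \pi_(modZ R) p%:R^-1 == 0 by exact/eqP.
  rewrite modZ_eq0 => /norm_intr_ge1.
  rewrite invr_eq0 pnatr_eq0 -lt0n p0 => /(_ isT); rewrite ger0_norm ?invr_ge0// leNgt.
  by rewrite invf_lt1 ?ltr0n// ltr1n p1.
(* Reducing the coefficient modulo p^n0 leaves finitely many multiples of x. *)
- rewrite radE; apply: (@sub_finite_set _ _ ((fun i => x *+ i) @` `I_(p ^ n0))).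
    move=> _ [m _ <-]; have qZ : (p ^ n0)%N%:Z != 0 by rewrite eqz_nat -lt0n.
    have r0 := modz_ge0 m qZ.
    have rq : (m %% (p ^ n0)%N)%Z < (p ^ n0)%N by rewrite ltz_pmod.
    exists `|(m %% (p ^ n0)%N)%Z|%N; first by rewrite /= -ltz_nat gez0_abs.
    by rewrite pmulrn gez0_abs// mulrz_modz.
  by apply: finite_image; exact: finite_II.
Qed.
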